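(* Let $r,t,n$ be integers with $1\le t<r$, and let $\mathcal{P}=\mathcal{P}_{n,t}^{(r)}$ be the $r$-uniform $t$-tight path of order $n$ and length $\ell>2$. Then $\chi^{e}(\mathcal{P})=2$ if either $t=\frac r2$, or ($t>\frac r2$, $r-t$ divides $r$, and $\ell\ge 2\frac{r}{r-t}-1$); otherwise $\chi^{e}(\mathcal{P})=1$.
   Context: The $r$-uniform $t$-tight path $\mathcal{P}_{n,t}^{(r)}$ is the hypergraph with vertex set $\{1,\dots,n\}$ and edges $e_1,\dots,e_\ell$, where $\ell=\frac{n-t}{r-t}$ is an integer and $e_i=\{(i-1)(r-t)+1,(i-1)(r-t)+2,\dots,(i-1)(r-t)+r\}$; consecutive edges share exactly $t$ vertices. For an edge weighting $w:E\to\{1,\dots,k\}$ put $\sigma^{e}(v)=\sum_{e\ni v}w(e)$. A vertex coloring is proper if every edge contains two vertices of distinct colors. $\chi^{e}(\mathcal{H})$ is the least $k$ such that some such $w$ makes $\sigma^{e}$ proper. *)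

(* Defs.v *)
From mathcomp Require Import all_boot.

Set Implicit Arguments.
Unset Strict Implicit.
Unset Printing Implicit Defensive.

Definition hypergraph (V : finType) := {set {set V}}.

Section EdgeWeightings.
Variables (V : finType) (H : hypergraph V).

Definition proper_coloring (c : V -> nat) : Prop :=
  forall e, e \in H -> exists u v, [/\ u \in e, v \in e & c u != c v].

(* A weighting is a function on all subsets of V; only its values on the edges
   of H are constrained or used. *)
Definition edge_weighting (k : nat) (w : {set V} -> nat) : Prop :=
  forall e, e \in H -> 1 <= w e <= k.

Definition edge_sum (w : {set V} -> nat) (v : V) : nat :=
  \sum_(e in H | v \in e) w e.

Definition edge_weight_colorable (k : nat) : Prop :=
  exists2 w, edge_weighting k w & proper_coloring (edge_sum w).

(* chi^e(H) = k.  A relation, since an arbitrary hypergraph (for instance one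
   with a singleton edge) may admit no suitable weighting for any k. *)
Definition is_chi_e (k : nat) : Prop :=
  edge_weight_colorable k /\ forall j, edge_weight_colorable j -> k <= j.

End EdgeWeightings.

Definition tight_path_length (r t n : nat) : nat := (n - t) %/ (r - t).

(* The ordinal v : 'I_n stands for the vertex v.+1 of {1, ..., n}, and the edge
   index i is 1-based. *)
Definition tight_path_edge (r t n i : nat) : {set 'I_n} :=
  [set v : 'I_n | (i - 1) * (r - t) + 1 <= v.+1 <= (i - 1) * (r - t) + r].

Definition tight_path (r t n : nat) : hypergraph 'I_n :=
  [set tight_path_edge r t n i.+1 | i : 'I_(tight_path_length r t n)].

(* Main.v *)
Require Import Defs.
From mathcomp Require Import all_boot.
From mathcomp Require Import zify.

(** Put d = r - t and number edges and vertices from 0, so that edge i is the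
    interval [id, id + r).  Two vertices of an edge are separated by comparing
    the sets of edges through them, which are chosen to differ in at most two
    edges.  If d does not divide r, then at position (i-1)d + r edge i-1 ends
    and no edge starts, so the constant weight separates that vertex from its
    predecessor.  If r = qd, moving from id to (i+1)d replaces edge i+1-q by
    edge i+1: a constant weight detects this only near the ends of the path, and
    when 2q-1 <= l the edge q-1 has all its vertices of degree q.  Weights
    constant on runs of q consecutive edges and alternating between 1 and 2
    detect it everywhere. *)

(* Taking a or b >= l encodes "no index": that term vanishes. *)
Lemma sum_swap l (f : nat -> nat) (P Q : pred nat) a b :
  (forall j, j < l -> P j + (j == a) = Q j + (j == b)) ->
  \sum_(j < l | P j) f j + (a < l) * f a =
  \sum_(j < l | Q j) f j + (b < l) * f b.
Proof.
move=> PQ.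
have atE c : (c < l) * f c = \sum_(j < l) (j == c :> nat) * f j.
  case: (ltnP c l) => cl.
    rewrite (bigD1 (Ordinal cl)) //= eqxx big1 ?addn0 // => j /negPf jc.
    by rewrite -[j == c :> nat]/(j == Ordinal cl) jc.
  rewrite big1 // => j _; case: eqP => // jc.
  by have := ltn_ord j; rewrite jc ltnNge cl.
have condE (R : pred nat) : \sum_(j < l | R j) f j = \sum_(j < l) R j * f j.
  by rewrite big_mkcond; apply: eq_bigr => j _; case: (R j); rewrite ?mul1n.
rewrite !atE !condE -!big_split; apply: eq_bigr => j _ /=.
by rewrite -!mulnDl PQ.
Qed.

(** The edge sum of the path at [v] when edge [j] has weight [f j], with [v] in [nat] so that
    vertices need no bound proof. *)
Definition interval_sum d r l (f : nat -> nat) v :=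
  \sum_(j < l | j * d <= v < j * d + r) f j.

Lemma interval_sum_swap d r l f u v a b :
  (forall j, j < l -> (j * d <= u < j * d + r) + (j == a) =
                      (j * d <= v < j * d + r) + (j == b)) ->
  interval_sum d r l f u + (a < l) * f a =
  interval_sum d r l f v + (b < l) * f b.
Proof.
exact: (sum_swap l f (fun j => j * d <= u < j * d + r)
  (fun j => j * d <= v < j * d + r)).
Qed.

Lemma interval_sum_multiple d q l f b : 0 < d ->
  interval_sum d (q * d) l f (b * d) = \sum_(j < l | j <= b < j + q) f j.
Proof.
by move=> d0; apply: eq_bigl => j; rewrite -mulnDl leq_pmul2r // ltn_pmul2r.
Qed.

(** Edge [j] covers the blocks [j, ..., j + q - 1] of [d] vertices each. The factor [q <= b.+1]
    guards against truncated subtraction, which would name edge 0 when no edge is lost. *)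
Lemma interval_sum_next d q l f b : 0 < d -> 0 < q ->
  interval_sum d (q * d) l f (b * d)
    + (b.+1 < l) * f b.+1 =
  interval_sum d (q * d) l f (b.+1 * d)
    + (q <= b.+1) * (b.+1 - q < l) * f (b.+1 - q).
Proof.
move=> d0 q0; rewrite !interval_sum_multiple //.
have swap := sum_swap l f (fun j => j <= b < j + q)
  (fun j => j <= b.+1 < j + q) b.+1.
case: (leqP q b.+1) => qb; first by rewrite mul1n (swap (b.+1 - q)) // => j jl; lia.
by rewrite (swap l) ?ltnn // => j jl; lia.
Qed.

(** With [m = v %/ d], the edges through [v] are those from [m + 1 - q] to [m]; the bounds on [v]
    make all [q] of them exist. *)
Lemma interval_sum_const d q l v : 0 < d -> q.-1 * d <= v < l * d ->
  interval_sum d (q * d) l (fun=> 1) v = q.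
Proof.
move=> d0 /andP[qv vl].
have {}qv : q.-1 <= v %/ d by rewrite leq_divRL.
have {}vl : v %/ d < l by rewrite ltn_divLR.
rewrite /interval_sum.
rewrite (eq_bigl (fun j : 'I_l => ((v %/ d).+1 - q <= j) && (j < (v %/ d).+1)));
  last first.
  move=> j; rewrite -mulnDl -leq_divRL // -ltn_divLR //; lia.
rewrite -(big_mkord (fun j => ((v %/ d).+1 - q <= j) && (j < (v %/ d).+1))
  (fun=> 1)).
rewrite (eq_bigl (fun j => ((v %/ d).+1 - q <= j) && true && (j < (v %/ d).+1)));
  last by move=> j; rewrite andbT.
rewrite -(big_nat_widen 0 _ _ (fun j => ((v %/ d).+1 - q <= j) && true)) //.
under eq_bigl do rewrite andbC.
by rewrite -big_nat_widenl // sum_nat_const_nat; lia.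
Qed.

Lemma ones_separate_indivisible d r l i :
  0 < d < r -> ~~ (d %| r) -> 1 < l -> i < l ->
  exists u v, [/\ i * d <= u < i * d + r, i * d <= v < i * d + r &
    interval_sum d r l (fun=> 1) u != interval_sum d r l (fun=> 1) v].
Proof.
move=> /andP[d0 dr] ndr l1; case: i => [|i] il.
  (* No edge ends before edge 0 does, so its start is used: vertex 0 lies in edge 0 only, vertex [d]
     in edges 0 and 1. *)
  exists 0, d; split; [lia | lia |].
  have := interval_sum_swap d r l (fun=> 1) 0 d 1 l.
  rewrite l1 ltnn => H.
  suff /H : forall j, j < l -> (j * d <= 0 < j * d + r) + (j == 1) =
      (j * d <= d < j * d + r) + (j == l) by lia.
  by move=> [|[|j]] jl; rewrite ?mulSn; lia.
exists (i * d + r).-1, (i * d + r); split; [nia | nia |].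
have := interval_sum_swap d r l (fun=> 1) (i * d + r).-1 (i * d + r) l i.
rewrite (ltnW il) ltnn => H.
suff /H : forall j, j < l ->
    (j * d <= (i * d + r).-1 < j * d + r) + (j == l) =
    (j * d <= i * d + r < j * d + r) + (j == i) by lia.
move=> j jl.
have neq : j * d <> i * d + r.
  move=> E; move: ndr; rewrite -(dvdn_addr r (dvdn_mull i (dvdnn d))) -E.
  by rewrite dvdn_mull.
rewrite ltn_eqF // addn0 ltn_add2r.
case: (ltngtP i j) => ij; last by subst j; lia.
  by rewrite (ltn_pmul2r d0) ij; nia.
by rewrite (ltn_pmul2r d0); nia.
Qed.

Lemma multiple_separate d q l f i : 0 < d -> 1 < q -> i < l ->
  (forall j, j < l -> 0 < f j) ->
  [\/ i.+1 < l /\ (q <= i.+1 -> f (i.+1 - q) != f i.+1) |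
      0 < i /\ l < i + q ] ->
  exists u v, [/\ i * d <= u < i * d + q * d, i * d <= v < i * d + q * d &
    interval_sum d (q * d) l f u != interval_sum d (q * d) l f v].
Proof.
move=> d0 q1 il f0 [[i1 fi]|[i0 lq]].
  exists (i * d), (i.+1 * d); split; [nia | nia |].
  have := interval_sum_next d q l f i d0 (ltnW q1).
  rewrite i1; have := f0 _ i1; case: (leqP q i.+1) fi => [_ /(_ isT)|_ _];
    last by lia.
  have -> : i.+1 - q < l by lia.
  by lia.
(* These vertices start the last two blocks of edge [i]. Between them edge [i - 1] is lost, and edge
   [i + q - 1], which would replace it, is beyond the end of the path. *)
exists ((i + q - 2) * d), ((i + q - 2).+1 * d); split; [nia | nia |].
have := interval_sum_next d q l f (i + q - 2) d0 (ltnW q1).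
have -> : (i + q - 2).+1 - q = i.-1 by lia.
have -> : ((i + q - 2).+1 < l) = false by lia.
have -> : q <= (i + q - 2).+1 by lia.
have il' : i.-1 < l by lia.
by rewrite il'; have := f0 _ il'; lia.
Qed.

Section TightPath.
Variables (r t n : nat).
Hypotheses (tr : 1 <= t < r) (dvd_len : r - t %| n - t).
Let d := r - t.
Let l := tight_path_length r t n.
Hypothesis l_gt0 : 0 < l.

Let E (i : 'I_l) := tight_path_edge r t n i.+1.

Let d_gt0 : 0 < d. Proof. by rewrite /d; lia. Qed.

Let nE : n = t + l * d.
Proof.
move: l_gt0 (divnK dvd_len); rewrite /l /tight_path_length => l0.
(* Positivity shows that the subtraction [n - t] is not truncated. *)
rewrite -/d => ld; have : 0 < n - t by rewrite -ld muln_gt0 l0.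
by rewrite ld; lia.
Qed.

Lemma mem_tight_path_edge i (v : 'I_n) :
  (v \in tight_path_edge r t n i.+1) = (i * (r - t) <= v < i * (r - t) + r).
Proof. by rewrite inE subn1 /= addn1 ltnS. Qed.

Lemma tight_path_vertex_lt i v : i < l -> v < i * d + r -> v < n.
Proof. by move=> il vi; rewrite nE; rewrite /d in vi *; nia. Qed.

(** The first vertex of edge [a] lies in edge [b] only if [b <= a]. Injectivity turns sums over the
    set of edges into sums over indices. *)
Lemma tight_path_edge_inj : injective E.
Proof.
move=> i j ij; apply: val_inj; apply: contraTeq isT => /= neq.
have sub (a b : 'I_l) : E a = E b -> b <= a.
  move=> ab; have an : a * d < n.
    by apply: (@tight_path_vertex_lt a) => //; lia.
  have : Ordinal an \in E a by rewrite mem_tight_path_edge /= -/d; lia.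
  by rewrite ab mem_tight_path_edge /= -/d leq_pmul2r // => /andP[].
by have := sub _ _ ij; have := sub _ _ (esym ij); lia.
Qed.

Lemma edge_sum_tight_path w f (v : 'I_n) : (forall i, w (E i) = f (val i)) ->
  edge_sum (tight_path r t n) w v = interval_sum d r l f v.
Proof.
move=> wE; rewrite /edge_sum /interval_sum big_mkcondr.
rewrite (big_imset _ (in2W tight_path_edge_inj)) /= [RHS]big_mkcond.
by apply: eq_bigr => i _; rewrite mem_tight_path_edge -/(E i) wE.
Qed.

Lemma tight_path_colorable k f : (forall j, j < l -> 1 <= f j <= k) ->
  (forall i, i < l -> exists u v,
    [/\ i * d <= u < i * d + r, i * d <= v < i * d + r &
      interval_sum d r l f u != interval_sum d r l f v]) ->
  edge_weight_colorable (tight_path r t n) k.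
Proof.
move=> fk sep.
pose w e := if [pick i | E i == e] is Some i then f (val i) else 0.
have wE i : w (E i) = f (val i).
  rewrite /w; case: pickP => [j /eqP/tight_path_edge_inj -> //|/(_ i)].
  by rewrite eqxx.
exists w => _ /imsetP[i _ ->]; first by rewrite -/(E i) wE; apply: fk (ltn_ord i).
have [u [v [ui vi uv]]] := sep i (ltn_ord i).
have un : u < n by apply: (@tight_path_vertex_lt i) => //; case/andP: ui.
have vn : v < n by apply: (@tight_path_vertex_lt i) => //; case/andP: vi.
exists (Ordinal un), (Ordinal vn).
by rewrite !mem_tight_path_edge !(edge_sum_tight_path _ f).
Qed.

Lemma tight_path_colorable_gt0 k :
  edge_weight_colorable (tight_path r t n) k -> 0 < k.
Proof.
case=> w wk _.
have /wk : E (Ordinal l_gt0) \in tight_path r t n by apply: imset_f.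
lia.
Qed.

Lemma tight_path_not_1_colorable : d %| r -> 2 * (r %/ d) - 1 <= l ->
  ~ edge_weight_colorable (tight_path r t n) 1.
Proof.
move=> dr ql [w w1 wP]; set q := r %/ d in ql.
have rq : r = q * d by rewrite divnK.
have q0 : 0 < q by rewrite divn_gt0 // dvdn_leq //; lia.
have il : q.-1 < l by lia.
have wE i : w (E i) = (fun=> 1) (val i).
  by have /w1 : E i \in tight_path r t n by [apply: imset_f]; lia.
have deg_q v : v \in E (Ordinal il) -> edge_sum (tight_path r t n) w v = q.
  rewrite mem_tight_path_edge /= -/d (edge_sum_tight_path w (fun=> 1) v wE) => vi.
  (* Edge [q - 1] covers the blocks [q - 1] to [2q - 2], all below [l]. *)
  by rewrite {1}rq interval_sum_const //; nia.
have /wP [u [v [/deg_q -> /deg_q ->]]] : E (Ordinal il) \in tight_path r t n.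
  exact: imset_f.
by rewrite eqxx.
Qed.

End TightPath.

Theorem theorem3p3 (r t n : nat) :
  1 <= t < r ->
  r - t %| n - t ->
  2 < tight_path_length r t n ->
  is_chi_e (tight_path r t n)
    (if (2 * t == r) ||
        [&& r < 2 * t, r - t %| r
          & 2 * (r %/ (r - t)) - 1 <= tight_path_length r t n]
     then 2 else 1).
Proof.
move=> tr dvd_len l2.
set d := r - t; set l := tight_path_length r t n in l2 *.
have l0 : 0 < l by lia.
have d0 : 0 < d by rewrite /d; lia.
(* The case t = r/2 is the case r / d = 2, in which 2 (r / d) - 1 <= l holds. *)
have -> : (2 * t == r) || [&& r < 2 * t, d %| r & 2 * (r %/ d) - 1 <= l] =
    (d %| r) && (2 * (r %/ d) - 1 <= l).
  case: eqP => [t2|/eqP t2] /=.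
    have rd : r = 2 * d by rewrite /d; lia.
    by rewrite rd dvdn_mull // mulnK // l2.
  case: (boolP (d %| r)) => dr; last by rewrite andbF.
  suff -> : r < 2 * t by [].
  have := divnK dr; set q := r %/ d => rq; rewrite /d in rq.
  (* Here [t = (q - 1) d]: [q <= 1] contradicts [1 <= t < r], [q = 2] is [t = r/2], and [q >= 3]
     gives [2t > r]. *)
  by case: q rq => [|[|[|q]]]; nia.
case: (boolP (d %| r)) => /= [dr|ndr]; last first.
  split; last exact: tight_path_colorable_gt0.
  apply: (@tight_path_colorable _ _ _ tr dvd_len l0 1 (fun=> 1)) => // i il.
  by apply: ones_separate_indivisible; rewrite -/d // /d; lia.
have := divnK dr; set q := r %/ d => rq.
have q1 : 1 < q by case: q rq => [|[|q]]; rewrite /d; lia.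
case: leqP => ql.
  split=> [|k kP]; last first.
    have k0 : 0 < k by apply: tight_path_colorable_gt0 kP.
    case: k k0 kP => [|[|k]] // _ kP; exfalso.
    by apply: tight_path_not_1_colorable kP.
  apply: (@tight_path_colorable _ _ _ tr dvd_len l0 2
    (fun j => 1 + odd (j %/ q))) => [j _|i il]; first by case: odd.
  rewrite -/d -/l -rq; apply: multiple_separate => //.
  (* Edges [i + 1 - q] and [i + 1] lie in consecutive runs; the last edge falls under the right-end
     case. *)
  case: (ltnP i.+1 l) => i1; [left | right; lia].
  split=> // qi; rewrite -{2}(subnK qi) divnDr ?dvdnn // divnn ltnW //= addn1 /=.
  by case: odd.
split; last exact: tight_path_colorable_gt0.
apply: (@tight_path_colorable _ _ _ tr dvd_len l0 1 (fun=> 1)) => // i il.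
rewrite -/d -/l -rq; apply: multiple_separate => //.
(* If [q <= i + 1], then [l < 2q - 1 <= i + q], the right-end case. Otherwise, unless edge [i] is
   last, edge [i + 1] enters and none is lost. *)
by case: (ltnP i.+1 l) => i1; case: (leqP q i.+1) => qi; (right; lia) || left.
Qed.
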